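(* Let $h=2k+1\ge 3$ be an odd integer (with $k$ an integer). Then there are exactly two $G$-orbits of $Q^*(\sqrt{2^h})$, namely $(2^k\sqrt 2)^G$ and $\left(\frac{2^k\sqrt 2}{-1}\right)^G$.
   Context: $G=\langle x,y: x^2=y^3=1\rangle$ is the modular group $PSL(2,\mathbb Z)$, generated by the linear fractional transformations $x: z\mapsto \frac{-1}{z}$ and $y: z\mapsto \frac{z-1}{z}$. For a positive non-square integer $n$, $$Q^*(\sqrt n)=\left\{\frac{a+\sqrt n}{c}: a,\ c,\ b=\frac{a^2-n}{c}\in\mathbb Z,\ c\neq 0,\ \gcd(a,b,c)=1\right\},$$ where $\sqrt n$ is the positive square root. This set is invariant under $G$. For $\alpha\in Q^*(\sqrt n)$, $\alpha^G$ denotes the orbit of $\alpha$ under $G$. *)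

(* Defs.v *)
From HB Require Import structures.
From mathcomp Require Import all_boot all_order all_algebra.
From mathcomp Require Import boolp classical_sets reals.

Set Implicit Arguments.
Unset Strict Implicit.
Unset Printing Implicit Defensive.

Import Order.TTheory GRing.Theory Num.Theory.

Local Open Scope classical_set_scope.
Local Open Scope ring_scope.

(* The real projective line R + {oo}, with [None] for the point at infinity:
   here linear fractional transformations are genuine bijections, with no
   recourse to the convention 0^-1 = 0. *)
Definition proj_line (R : realType) : Type := option R.

(* z |-> -1 / z *)
Definition modular_x (R : realType) (z : proj_line R) : proj_line R :=
  match z with
  | Some t => if t == 0 then None else Some (-1 / t)
  | None => Some 0
  end.

(* z |-> (z - 1) / z *)
Definition modular_y (R : realType) (z : proj_line R) : proj_line R :=
  match z with
  | Some t => if t == 0 then None else Some ((t - 1) / t)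
  | None => Some 1
  end.

(* The third clause only concerns bijections, and says that their inverses
   stay in [A]. *)
Definition transformation_group (T : Type) (A : set (T -> T)) : Prop :=
  [/\ A id,
      (forall f g, A f -> A g -> A (f \o g)) &
      (forall f g, A f -> cancel f g -> cancel g f -> A g)].

(* PSL(2, Z), as the group of transformations generated by x and y. *)
Definition modular_group (R : realType) : set (proj_line R -> proj_line R) :=
  smallest (@transformation_group (proj_line R))
           [set @modular_x R; @modular_y R].
Arguments modular_group R : clear implicits.

(* The orbit z^G. *)
Definition modular_orbit (R : realType) (z : proj_line R) :
    set (proj_line R) :=
  [set g z | g in modular_group R].

(* Q^*(sqrt n), meant for positive non-square n. *)
Definition Qstar (R : realType) (n : nat) : set R :=
  [set alpha | exists a b c : int,
    [/\ c != 0,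
        b * c = a ^+ 2 - n%:Z,
        gcdz (gcdz a b) c = 1 &
        alpha = (a%:~R + Num.sqrt n%:R) / c%:~R]].
Arguments Qstar R n : clear implicits.

(* The set of G-orbits of Q^*(sqrt n). *)
Definition Qstar_orbits (R : realType) (n : nat) : set (set (proj_line R)) :=
  [set modular_orbit (Some alpha : proj_line R) | alpha in Qstar R n].
Arguments Qstar_orbits R n : clear implicits.

(* Main.v *)
(* Write [(a + sqrt n) / c] as a root of [c X^2 - 2 a X + b], a form of
   determinant [- n].  For [n = 2] reduction brings every form to
   [+- (X^2 - 2 Y^2)].  Passing from [n] to [4 n], a form with [c] odd can be
   translated so that [a] is even, hence [4] divides [b], and it is the pullback
   of a form of determinant [- n] along [diag (1, 2)].  The units
   [u + v sqrt n] with [v] odd, obtained by squaring [1 + sqrt 2], act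
   transitively on the sublattices involved, so a [GL2]-matrix of determinant 2
   can be traded for an [SL2]-matrix.  The roots [sqrt n] and [- sqrt n] are
   separated by the residue mod 4 of the odd values of their forms. *)
Require Import Defs.
From HB Require Import structures.
From mathcomp Require Import all_boot all_order all_algebra.
From mathcomp Require Import boolp classical_sets reals.
From mathcomp Require Import zify ring.

Set Implicit Arguments.
Unset Strict Implicit.
Unset Printing Implicit Defensive.

Import Order.TTheory GRing.Theory Num.Theory.

Local Open Scope classical_set_scope.
Local Open Scope ring_scope.

(** * Arithmetic of the forms: reduction and descent on the power of 2 *)

Lemma int_parity (a : int) : exists m : int, a = 2 * m \/ a = 2 * m + 1.
Proof. by exists (a %/ 2)%Z; lia. Qed.

Lemma centered_division (a c : int) :
  c != 0 -> exists m : int, 2 * `|a + m * c| <= `|c|.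
Proof.
move=> c0.
have h1 := divz_eq a c; have h2 := modz_ge0 a c0; have h3 := ltz_mod a c0.
move: (a %/ c)%Z (a %% c)%Z h1 h2 h3 => q r -> h2 h3.
have [le|lt] := lerP (2 * r) `|c|.
  exists (- q); have -> : q * c + r + - q * c = r by ring.
  by rewrite ger0_norm.
exists (- q - Num.sg c).
have -> : q * c + r + (- q - Num.sg c) * c = r - Num.sg c * c by ring.
by rewrite -normrEsg; lia.
Qed.

(* [(a + sqrt n) / c], with [b = (a ^ 2 - n) / c], is the image of
   [e * sqrt n] under [z |-> (p z + r) / (s z + t)]. *)
Definition sqrt_image (n a b c : int) : Prop :=
  exists e p r s t : int,
    [/\ e = 1 \/ e = -1, p * t - r * s = 1, c = e * (t ^+ 2 - n * s ^+ 2),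
        a = e * (r * t - n * p * s) & b = e * (r ^+ 2 - n * p ^+ 2)].

(** The matrix is multiplied on the left by that of [z |-> z - m]. *)
Lemma sqrt_image_translate (m n a b c : int) :
  sqrt_image n (a + m * c) (b + 2 * a * m + c * m ^+ 2) c ->
  sqrt_image n a b c.
Proof.
move=> [e [p [r [s [t [he hd hc ha hb]]]]]].
exists e, (p - m * s), (r - m * t), s, t; split=> //.
- by apply: etrans hd; ring.
- have -> : a = (a + m * c) - m * c by ring.
  by rewrite ha hc; ring.
- have -> : b = (b + 2 * a * m + c * m ^+ 2)
      - 2 * m * (a + m * c) + c * m ^+ 2 by ring.
  by rewrite ha hb hc; ring.
Qed.

Lemma sqrt_image_swap (n a b c : int) :
  sqrt_image n (- a) c b -> sqrt_image n a b c.
Proof.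
move=> [e [p [r [s [t [he hd hc ha hb]]]]]].
exists e, (- s), (- t), p, r; split=> //.
- by apply: etrans hd; ring.
- by rewrite -[a]opprK ha; ring.
- by rewrite hc; ring.
Qed.

(** Induction on [|c|]: centre [a] modulo [c], then swap [b] and [c] if [|b| < |c|]. Otherwise
    [c ^ 2 <= |a ^ 2 - 2|] with [2 |a| <= |c|], which leaves only [a = 0] and [|c| = 1]. *)
Lemma sqrt_image2 (a b c : int) :
  b * c = a ^+ 2 - 2 -> sqrt_image 2 a b c.
Proof.
have [N] := ubnP `|c|%N; elim: N a b c => // N IH a b c lecN bc.
have c0 : c != 0.
  apply/eqP => c0; move: bc; rewrite c0 mulr0 => bc.
  have [m [am|am]] := int_parity a; subst a; nia.
have [m hm] := centered_division a c0.
apply: (@sqrt_image_translate m).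
have {bc} : (b + 2 * a * m + c * m ^+ 2) * c = (a + m * c) ^+ 2 - 2.
  by rewrite !mulrDl bc; ring.
move: (a + m * c) (b + 2 * a * m + c * m ^+ 2) hm => {m}{}a {}b ha bc.
have [lt|le] := ltnP `|b|%N `|c|%N.
  apply/sqrt_image_swap/IH; first by lia.
  by rewrite sqrrN -bc mulrC.
have le2 : `|c| * `|c| <= `|a ^+ 2 - 2|.
  by rewrite -bc normrM; apply: ler_wpM2r; lia.
have c1 : `|c| = 1 by nia.
have a0 : a = 0 by lia.
exists c, 1, 0, 0, 1; subst a; split; [lia|ring|ring|ring|].
have cc : c * c = 1 by nia.
have : b * c * c = (0 ^+ 2 - 2) * c by rewrite bc.
by rewrite -mulrA cc; lia.
Qed.

Lemma pell_odd (k : nat) : exists u v : int,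
  u ^+ 2 - 2 ^+ (2 * k + 1) * (2 * v + 1) ^+ 2 = 1 \/
  u ^+ 2 - 2 ^+ (2 * k + 1) * (2 * v + 1) ^+ 2 = -1.
Proof.
elim: k => [|k [u [v H]]]; first by exists 1, 0; right.
rewrite (_ : (2 * k.+1 + 1 = (2 * k + 1).+2)%N); last by lia.
have [N HN] : exists N : int, 2 ^+ (2 * k + 1) = 2 * N.
  by exists (2 ^+ (2 * k)); rewrite exprD expr1 mulrC.
rewrite (_ : 2 ^+ _.+2 = 4 * 2 ^+ (2 * k + 1)); last by rewrite !exprS; ring.
rewrite HN in H *.
have [w [hw|hw]] := int_parity u; first by lia.
(* Squaring [u + (2 v + 1) sqrt n] gives [sqrt (4 n)] the coefficient [u (2 v + 1)], odd because [u]
   is odd. *)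
exists (u ^+ 2 + 2 * N * (2 * v + 1) ^+ 2), (2 * w * v + w + v).
left; transitivity ((u ^+ 2 - 2 * N * (2 * v + 1) ^+ 2) ^+ 2).
  by rewrite hw; ring.
by case: H => ->; ring.
Qed.

(* The matrix hypothesis has lower left entry [2 * s]; conjugating it by
   [diag (2, 1)] keeps it integral. *)
Lemma sqrt_image_mul4 (n a b c : int) :
  (exists e p r s t : int,
    [/\ e = 1 \/ e = -1, p * t - r * (2 * s) = 1,
        c = e * (t ^+ 2 - n * (2 * s) ^+ 2),
        a = e * (r * t - n * p * (2 * s)) & b = e * (r ^+ 2 - n * p ^+ 2)]) ->
  sqrt_image (4 * n) (2 * a) (4 * b) c.
Proof.
move=> [e [p [r [s [t [he hd hc ha hb]]]]]].
exists e, p, (2 * r), s, t; split=> //.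
- by apply: etrans hd; ring.
- by rewrite hc; ring.
- by rewrite ha; ring.
- by rewrite hb; ring.
Qed.

(** The descent divides [a] by 2 and [b] by 4 but leaves the odd third coefficient alone, so the
    hypothesis persists down to [n = 2]. *)
Lemma sqrt_image_odd (k : nat) (a b c : int) :
  b * (2 * c + 1) = a ^+ 2 - 2 ^+ (2 * k + 1) ->
  sqrt_image (2 ^+ (2 * k + 1)) a b (2 * c + 1).
Proof.
elim: k a b => [|k IH] a b; first by rewrite expr1; exact: sqrt_image2.
rewrite (_ : (2 * k.+1 + 1 = (2 * k + 1).+2)%N); last by lia.
rewrite (_ : 2 ^+ _.+2 = 4 * 2 ^+ (2 * k + 1)); last by rewrite !exprS; ring.
move: (pell_odd k) IH.
have [N ->] : exists N : int, 2 ^+ (2 * k + 1) = 2 * N.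
  by exists (2 ^+ (2 * k)); rewrite exprD expr1 mulrC.
move=> pell IH.
(* Translating by 1 adds the odd number [2 * c + 1] to [a], so [a] may be taken even. *)
wlog [d ->] : a b / exists d, a = 2 * d.
  move=> hw bc; have [d [had|had]] := int_parity a; first by apply: hw; eauto.
  apply: (@sqrt_image_translate 1); apply: hw.
    by exists (d + c + 1); rewrite had; ring.
  transitivity (b * (2 * c + 1) + 2 * a * (2 * c + 1) + (2 * c + 1) ^+ 2).
    by ring.
  by rewrite bc; ring.
move=> bc.
have [b' hb'] : exists b', b = 4 * b'.
  have [b1 [hb|hb]] := int_parity b; last by lia.
  by have [b2 [hb1|hb1]] := int_parity b1; subst; [exists b2; ring | lia].
subst b.
have {}bc : b' * (2 * c + 1) = d ^+ 2 - 2 * N by lia.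
have [e [p [r [s [t [he hd hc ha hb]]]]]] := IH _ _ bc.
apply: sqrt_image_mul4.
have [s' [hs|hs]] := int_parity s.
  by exists e, p, r, s', t; rewrite -hs.
(* With [s] odd, an even [t] would make the third coefficient even. As [u] is odd too,
   [s * u + t * (2 * v + 1)] is a sum of two odd numbers. *)
have [t' [ht|ht]] := int_parity t.
  by move: hc; rewrite ht; clear -he; case: he => ->; lia.
have [u [v uv]] := pell.
have [w [hw|hw]] := int_parity u.
  by move: uv; rewrite hw; clear; case; lia.
(* Right multiplication by the unit [u + (2 v + 1) sqrt (2 N)] fixes
   [sqrt (2 N)] up to sign and makes the lower left entry even. *)
case: uv => uv.
  exists e, (p * u + r * (2 * v + 1)), (2 * N * p * (2 * v + 1) + r * u).
  exists (s * w + s' + t * v + t' + 1), (2 * N * s * (2 * v + 1) + t * u).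
  have -> : 2 * (s * w + s' + t * v + t' + 1) = s * u + t * (2 * v + 1).
    by rewrite hw {1 2}hs ht; ring.
  split=> //.
  - transitivity ((p * t - r * s) * (u ^+ 2 - 2 * N * (2 * v + 1) ^+ 2)).
      by ring.
    by rewrite hd uv mulr1.
  - rewrite hc -[LHS]mulr1 -[X in _ * X = _]uv; ring.
  - rewrite ha -[LHS]mulr1 -[X in _ * X = _]uv; ring.
  - rewrite hb -[LHS]mulr1 -[X in _ * X = _]uv; ring.
(* A unit of norm -1 gives a product of determinant -1; negating its second column restores 1, and
   [e] changes sign. *)
exists (- e), (p * u + r * (2 * v + 1)), (- (2 * N * p * (2 * v + 1) + r * u)).
exists (s * w + s' + t * v + t' + 1), (- (2 * N * s * (2 * v + 1) + t * u)).
have -> : 2 * (s * w + s' + t * v + t' + 1) = s * u + t * (2 * v + 1).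
  by rewrite hw {1 2}hs ht; ring.
have {}uv : 2 * N * (2 * v + 1) ^+ 2 - u ^+ 2 = 1.
  by rewrite -[RHS]opprK -uv; ring.
split=> //.
- by case: he => ->; [right|left].
- transitivity ((p * t - r * s) * (2 * N * (2 * v + 1) ^+ 2 - u ^+ 2)).
    by ring.
  by rewrite hd uv mulr1.
- rewrite hc -[LHS]mulr1 -[X in _ * X = _]uv; ring.
- rewrite ha -[LHS]mulr1 -[X in _ * X = _]uv; ring.
- rewrite hb -[LHS]mulr1 -[X in _ * X = _]uv; ring.
Qed.

(** * The modular group acting on the projective line *)

(** Euclid's algorithm on the first column: a translation brings [|p|] to at most half of [|s|], and
    a swap then puts [p], up to sign, in place of [s]. *)
Lemma SL2Z_ind (P : int -> int -> int -> int -> Prop) :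
  P 1 0 0 1 ->
  (forall m p r s t, P p r s t -> P (p + m * s) (r + m * t) s t) ->
  (forall p r s t, P p r s t -> P (- s) (- t) p r) ->
  forall p r s t, p * t - r * s = 1 -> P p r s t.
Proof.
move=> P1 PT PS p r s t.
have [N] := ubnP `|s|%N; elim: N p r s t => // N IH p r s t lesN det.
have [s0|s0] := eqVneq s 0.
  subst s; rewrite mulr0 subr0 in det.
  have [[-> ->]|[-> ->]] : (p = 1 /\ t = 1) \/ (p = -1 /\ t = -1).
    have /eqP := congr1 absz det.
    rewrite abszM muln_eq1 => /andP[/eqP p1 /eqP t1].
    by clear -det p1 t1; nia.
    by have := PT r _ _ _ _ P1; rewrite mulr0 mulr1 addr0 add0r.
  (* Two swaps turn the identity into its opposite. *)
  have := PT (- r) _ _ _ _ (PS _ _ _ _ (PS _ _ _ _ P1)).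
  by rewrite oppr0 mulr0 mulrNN mulr1 addr0 add0r.
have [m hm] := centered_division p s0.
have -> : p = p + m * s + - m * s by ring.
have -> : r = r + m * t + - m * t by ring.
apply: PT; rewrite -[p + _]opprK -[r + _]opprK; apply/PS.
by apply: IH; [lia | rewrite -det; ring].
Qed.

Lemma modular_group_transformation (R : realType) :
  transformation_group (modular_group R).
Proof.
split=> [A [[]] //|f g Gf Gg A hA|f g Gf fg gf A hA].
  by have [[_ comp _] _] := hA; apply: comp; [exact: Gf|exact: Gg].
by have [[_ _ inv] _] := hA; apply: inv fg gf; exact: Gf.
Qed.

Lemma modular_group_min (R : realType) (A : set (proj_line R -> proj_line R)) :
  transformation_group A -> A (@modular_x R) -> A (@modular_y R) ->
  modular_group R `<=` A.
Proof. by move=> tA Ax Ay g Gg; apply: Gg; split=> // _ [->|->]. Qed.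

Lemma modular_group_x (R : realType) : modular_group R (@modular_x R).
Proof. by move=> A [_]; apply; left. Qed.

Lemma modular_group_y (R : realType) : modular_group R (@modular_y R).
Proof. by move=> A [_]; apply; right. Qed.

Lemma modular_xK (R : realType) : involutive (@modular_x R).
Proof.
move=> [t|] /=; last by rewrite eqxx.
have [->//|t0] := eqVneq t 0.
rewrite /= mulf_eq0 invr_eq0 oppr_eq0 oner_eq0 (negbTE t0) /=.
by congr Some; field.
Qed.

Lemma modular_y3 (R : realType) (z : proj_line R) :
  modular_y (modular_y (modular_y z)) = z.
Proof.
case: z => [t|] /=; last by rewrite oner_eq0 /= subrr mul0r eqxx.
have [->|t0] := eqVneq t 0; first by rewrite /= oner_eq0 /= subrr mul0r.
rewrite /= mulf_eq0 invr_eq0 (negbTE t0) orbF subr_eq0.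
have [->//|t1] := eqVneq t 1.
have t10 : t - 1 != 0 by rewrite subr_eq0.
have -> : ((t - 1) / t - 1) / ((t - 1) / t) = -1 / (t - 1).
  by field; rewrite t0 t10.
rewrite /= mulf_eq0 invr_eq0 oppr_eq0 oner_eq0 (negbTE t10) /=.
by congr Some; field.
Qed.

Lemma modular_group_bij (R : realType) g :
  modular_group R g -> bijective g.
Proof.
move: g; apply: modular_group_min.
- split=> [|f g|f g _ fg gf]; first by exists id.
  + exact: bij_comp.
  + by exists f.
- exact: inv_bij (@modular_xK R).
- by exists (fun z => modular_y (modular_y z)) => z; exact: modular_y3.
Qed.

Lemma modular_orbit_eq (R : realType) g (z : proj_line R) :
  modular_group R g -> modular_orbit (g z) = modular_orbit z.
Proof.
move=> Gg; have [_ comp inv] := modular_group_transformation R.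
have [g' gK g'K] := modular_group_bij Gg.
apply/seteqP; split=> _ [f Gf <-].
  by exists (f \o g) => //; exact: comp.
exists (f \o g'); last by rewrite /= gK.
by apply: comp => //; exact: inv gK g'K.
Qed.

Lemma modular_group_translation (R : realType) (m : int) :
  exists2 g, modular_group R g & forall a, g (Some a) = Some (a + m%:~R).
Proof.
have [id1 comp inv] := modular_group_transformation R.
(* [x] followed by [y] is [z |-> z + 1]; at 0 it passes through infinity. *)
have GT : modular_group R (@modular_y R \o @modular_x R).
  by apply: comp; [exact: modular_group_y | exact: modular_group_x].
have TE a : (@modular_y R \o @modular_x R) (Some a) = Some (a + 1).
  rewrite /=; have [->|a0] := eqVneq a 0; first by rewrite add0r.
  rewrite /= mulf_eq0 invr_eq0 oppr_eq0 oner_eq0 (negbTE a0) /=.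
  by congr Some; field.
have natT (n : nat) :
    exists2 g, modular_group R g & forall a, g (Some a) = Some (a + n%:R).
  elim: n => [|n [g Gg gE]]; first by exists id => // a; rewrite addr0.
  exists (g \o (@modular_y R \o @modular_x R)); first exact: comp.
  move=> a; rewrite -[LHS]/(g ((@modular_y R \o @modular_x R) (Some a))) TE gE.
  by rewrite -addrA -natr1 [1 + _]addrC.
case: (intP m) => [|n|n].
- by exists id => // a; rewrite addr0.
- exact: natT.
have [g Gg gE] := natT n.+1; have [g' gK g'K] := modular_group_bij Gg.
exists g'; first exact: inv gK g'K.
move=> a; rewrite -{1}[a](subrK n.+1%:R) -gE gK.
by rewrite mulrNz.
Qed.

Lemma modular_group_mobius (R : realType) (p r s t : int) :
  p * t - r * s = 1 ->
  exists2 g, modular_group R g &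
    forall a : R, (forall u v : int, u%:~R * a + v%:~R = 0 -> u = 0 /\ v = 0) ->
    g (Some a) = Some ((p%:~R * a + r%:~R) / (s%:~R * a + t%:~R)).
Proof.
have [id1 comp inv] := modular_group_transformation R.
(* The determinant equation is duplicated so that the induction predicate carries it: it keeps each
   row nonzero, hence numerators and denominators nonzero at an irrational [a]. *)
move=> det; move: (det); move: p r s t det.
apply: SL2Z_ind => [_|m p r s t IH det|p r s t IH det].
- by exists id => // a _; rewrite mul1r mul0r addr0 add0r divr1.
- have {}det : p * t - r * s = 1 by rewrite -det; ring.
  have [g Gg gE] := IH det; have [f Gf fE] := modular_group_translation R m.
  exists (f \o g); first exact: comp.
  move=> a irr; rewrite /= gE // fE; congr Some.
  have d0 : s%:~R * a + t%:~R != 0.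
    by apply/eqP => /irr[s0 t0]; move: det; rewrite s0 t0; lia.
  rewrite !intrD !intrM; field.
  by [].
have {}det : p * t - r * s = 1 by rewrite -det; ring.
have [g Gg gE] := IH det.
exists (@modular_x R \o g); first by apply: comp => //; exact: modular_group_x.
move=> a irr; rewrite /= gE //=.
have d0 : s%:~R * a + t%:~R != 0.
  by apply/eqP => /irr[s0 t0]; move: det; rewrite s0 t0; lia.
have n0 : p%:~R * a + r%:~R != 0.
  by apply/eqP => /irr[p0 r0]; move: det; rewrite p0 r0; lia.
rewrite mulf_eq0 invr_eq0 (negbTE d0) (negbTE n0) /=; congr Some.
rewrite !mulrNz; field.
by rewrite d0 n0.
Qed.

(** * Irrationality, and the orbits of the roots *)

Lemma odd_pow2_nonsquare (k : nat) (x y : int) :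
  x ^+ 2 * 2 ^+ (2 * k + 1) = y ^+ 2 -> x = 0 /\ y = 0.
Proof.
have [->|x0] := eqVneq x 0.
  by rewrite expr0n mul0r => /esym/eqP; rewrite sqrf_eq0 => /eqP.
move=> /(congr1 absz); rewrite abszM !abszX => H; exfalso.
(* The 2-adic valuation is odd on the left and even on the right; for [y = 0] the default
   [logn 2 0 = 0] is even too. *)
have := congr1 (logn 2) H.
rewrite lognM ?expn_gt0 ?absz_gt0 ?x0 // !lognX
  (_ : logn 2 `|2 : int| = 1)%N //.
lia.
Qed.

Lemma sqrt_image_in_orbit (R : realType) (n : nat) (w : R) (a b c : int) :
  w ^+ 2 = n%:R ->
  (forall u v : int, u%:~R * w + v%:~R = 0 -> u = 0 /\ v = 0) ->
  c != 0 -> sqrt_image n a b c ->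
  modular_orbit (Some ((a%:~R + w) / c%:~R) : proj_line R) =
    modular_orbit (Some w : proj_line R) \/
  modular_orbit (Some ((a%:~R + w) / c%:~R) : proj_line R) =
    modular_orbit (Some (- w) : proj_line R).
Proof.
move=> w2 irr c0 [e [p [r [s [t [he det hc ha hb]]]]]].
have [g Gg gE] := modular_group_mobius R det.
have irre (u v : int) : u%:~R * (e%:~R * w) + v%:~R = 0 -> u = 0 /\ v = 0.
  by rewrite mulrA -intrM => /irr[]; case: he => ->; lia.
have d0 : s%:~R * (e%:~R * w) + t%:~R != 0.
  by apply/eqP => /irre[s0 t0]; move: det; rewrite s0 t0; lia.
have cE : c%:~R = e%:~R * (t%:~R ^+ 2 - w ^+ 2 * s%:~R ^+ 2) :> R.
  by rewrite w2 hc !(intrM, intrB, rmorphXn).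
have aE : a%:~R = e%:~R * (r%:~R * t%:~R - w ^+ 2 * p%:~R * s%:~R) :> R.
  by rewrite w2 ha !(intrM, intrB).
have detR : p%:~R * t%:~R - r%:~R * s%:~R = 1 :> R.
  by rewrite -!intrM -intrB det.
have -> : Some ((a%:~R + w) / c%:~R) = g (Some (e%:~R * w)).
  rewrite gE //; congr Some; apply/eqP; rewrite eqr_div ?intr_eq0 //; apply/eqP.
  rewrite aE cE; apply/eqP; rewrite -subr_eq0; apply/eqP.
  transitivity (w * (s%:~R * (e%:~R * w) + t%:~R) *
                (1 - (p%:~R * t%:~R - r%:~R * s%:~R))); last first.
    by rewrite detR subrr mulr0.
  by case: he => ->; rewrite ?mulrN1z ?mulr1z; ring.
rewrite modular_orbit_eq //.
by case: he => ->; [left|right]; rewrite ?mulrN1z ?mulr1z ?mul1r ?mulN1r.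
Qed.

(* A form [c X^2 - 2 a X Y + b Y^2] of determinant [- 4 m] with an odd
   coefficient is [+ L^2] or [- L^2] mod 4; [S] collects the roots of the forms
   of the first kind. *)
Lemma mod4_invariant (R : realType) (m : int) (w : R)
    (g : proj_line R -> proj_line R) :
  let S z := exists a b c d : int,
    [/\ b * c = a ^+ 2 - 4 * m, c != 0, z = Some ((a%:~R + w) / c%:~R) &
        b = 4 * d + 1 \/ c = 4 * d + 1] in
  w ^+ 2 = (4 * m)%:~R ->
  (forall u v : int, u%:~R * w + v%:~R = 0 -> u = 0 /\ v = 0) ->
  modular_group R g -> forall z, S z <-> S (g z).
Proof.
move=> S w2 irr.
have nz (u v : int) : u != 0 -> u%:~R * w + v%:~R != 0.
  by move=> u0; apply/eqP => /irr[]; move/eqP: u0.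
have root0 (a : int) : a%:~R + w != 0.
  by have := @nz 1 a isT; rewrite mul1r addrC.
have b_neq0 (a b c : int) : b * c = a ^+ 2 - 4 * m -> b != 0.
  move=> bc; apply: contraNneq (root0 a) => b0.
  have /eqP : (a%:~R + w) * (- a%:~R + w) = 0.
    have /eqP := bc; rewrite b0 mul0r eq_sym subr_eq0 => /eqP am.
    have -> : (a%:~R + w) * (- a%:~R + w) = w ^+ 2 - a%:~R ^+ 2 by ring.
    by rewrite w2 -am -rmorphXn subrr.
  by rewrite mulf_eq0 -mulrNz (negbTE (root0 (- a))) orbF.
(* [- c / (a + w) = (- a + w) / b] because [b * c = a ^ 2 - w ^ 2]. *)
have inv_root (a b c : int) : b * c = a ^+ 2 - 4 * m ->
    c%:~R / (a%:~R + w) = (a%:~R - w) / b%:~R.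
  move=> bc; apply/eqP; rewrite eqr_div ?intr_eq0 ?(b_neq0 _ _ _ bc) //.
  apply/eqP; rewrite -intrM [c * b]mulrC bc intrB rmorphXn -w2; ring.
have Sx z : S z -> S (modular_x z).
  move=> [a [b [c [d [bc c0 -> h]]]]]; exists (- a), c, b, d.
  split; [by rewrite sqrrN mulrC | exact: b_neq0 bc | | by case: h; auto].
  rewrite /= mulf_eq0 invr_eq0 intr_eq0 (negbTE c0) (negbTE (root0 a)) /=.
  congr Some; rewrite mulN1r invf_div (inv_root _ _ _ bc).
  by rewrite -mulNr opprB mulrNz addrC.
have Sy z : S z -> S (modular_y z).
  move=> [a [b [c [d [bc c0 -> h]]]]].
  have [e he] : exists e, b = 4 * e + 1 \/ c - 2 * a + b = 4 * e + 1.
    case: h => h; first by exists d; left.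
    (* When [c] is 1 modulo 4, [b] is congruent to [a ^ 2]: it is 1 for [a] odd, and for [a] even
       [c - 2 * a + b] is 1. *)
    have [q [hq|hq]] := int_parity a.
      exists (q ^+ 2 - m - b * d + d - q).
      by right; subst; lia.
    exists (q ^+ 2 + q - m - b * d); left; subst; lia.
  exists (b - a), (c - 2 * a + b), b, e; split.
  - transitivity (b * c - 2 * a * b + b ^+ 2); first by ring.
    by rewrite bc; ring.
  - exact: b_neq0 bc.
  - rewrite /= mulf_eq0 invr_eq0 intr_eq0 (negbTE c0) (negbTE (root0 a)) /=.
    have b0 := b_neq0 _ _ _ bc.
    congr Some; rewrite mulrBl divff ?mul1r ?invf_div; last first.
      by rewrite mulf_neq0 ?invr_eq0 ?intr_eq0 ?root0.
    rewrite (inv_root _ _ _ bc) intrB; field.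
    by rewrite intr_eq0.
  - by case: he; auto.
(* Stating invariance as an equivalence lets it pass to inverses; for the generators the converse
   comes from [x ^ 2 = y ^ 3 = 1]. *)
move: g; apply: modular_group_min.
- split=> [//|f g Sf Sg z|f g Sf fg gf z].
    exact: iff_trans (Sg z) (Sf (g z)).
  by apply: iff_sym; have := Sf (g z); rewrite gf.
- by move=> z; split=> [/Sx//|/Sx]; rewrite modular_xK.
- by move=> z; split=> [/Sy//|/Sy/Sy]; rewrite modular_y3.
Qed.

Theorem theorem2p8 (R : realType) (h k : nat)
    (hk : h = (2 * k + 1)%N) (h_ge3 : (3 <= h)%N) :
  let alpha : R := 2 ^+ k * Num.sqrt 2 in
  let O1 := modular_orbit (Some alpha : proj_line R) in
  let O2 := modular_orbit (Some (alpha / -1) : proj_line R) in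
  Qstar_orbits R (2 ^ h) = [set O1; O2] /\ O1 <> O2.
Proof.
move=> alpha O1 O2.
have nE : ((2 ^ h)%N : int) = 2 ^+ (2 * k + 1) by rewrite hk -natz natrX.
have [m mE] : exists m : int, ((2 ^ h)%N : int) = 4 * m.
  have [j ->] : exists j, h = j.+2 by exists (h - 2)%N; lia.
  by exists (2 ^+ j); rewrite -natz natrX !exprS; ring.
have a2 : alpha ^+ 2 = (2 ^ h)%:R.
  by rewrite /alpha exprMn sqr_sqrtr ?ler0n // -exprM -exprSr
    natrX hk mulnC addn1.
have a_ge0 : 0 <= alpha by rewrite mulr_ge0 ?exprn_ge0 ?sqrtr_ge0 ?ler0n.
have sqrtE : Num.sqrt (2 ^ h)%:R = alpha by rewrite -a2 sqrtr_sqr ger0_norm.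
have irr (u v : int) : u%:~R * alpha + v%:~R = 0 -> u = 0 /\ v = 0.
  move=> /eqP; rewrite addr_eq0 => /eqP/(congr1 (fun z => z ^+ 2)).
  rewrite sqrrN exprMn a2 => H; apply: (@odd_pow2_nonsquare k).
  apply/eqP; rewrite -(@eqr_int R) -nE intrM !rmorphXn /=.
  by apply/eqP.
rewrite /O2 invrN1 mulrN1; split.
  apply/seteqP; split=> [_ [_ [a [b [c [c0 bc abc ->]]]] <-]|].
    rewrite sqrtE; apply: (sqrt_image_in_orbit (b := b) a2 irr c0).
    rewrite nE in bc *.
    (* If [b] and [c] were both even, so would be [a], against coprimality; an odd [b] is brought
       into the place of [c] by the swap. *)
    have [c' [hc|hc]] := int_parity c; last by subst; apply: sqrt_image_odd.
    have [b' [hb|hb]] := int_parity b; last first.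
      apply: sqrt_image_swap; rewrite hb; apply: sqrt_image_odd.
      by rewrite sqrrN -bc hb mulrC.
    have [a' [ha|ha]] := int_parity a; last first.
      by rewrite -nE mE in bc; clear -bc ha hb hc; subst; lia.
    have : (2 %| gcdz (gcdz a b) c)%Z by rewrite !dvdz_gcd ha hb hc !dvdz_mulr.
    by rewrite abc.
  move=> _ [->|->].
  - exists alpha => //; exists 0, (- (2 ^ h)%N%:Z), 1.
    split; rewrite ?sqrtE ?mulr0z ?add0r ?divr1 //.
    by rewrite gcdz1.
  - exists (- alpha) => //; exists 0, (2 ^ h)%N, (-1).
    split; rewrite ?sqrtE ?mulr0z ?add0r ?mulrN1z ?invrN1 ?mulrN1 //.
    by rewrite gcdzN gcdz1.
have w2 : alpha ^+ 2 = (4 * m)%:~R by rewrite a2 -mE.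
(* Equal orbits would make [- alpha] a root of the first kind, like [alpha]. Irrationality then
   forces [a = 0], [c = -1] and [b = 4 * m], and neither [b] nor [c] is 1 modulo 4. *)
move=> O12.
have [g Gg gE] : O1 (Some (- alpha)).
  by rewrite O12; exists id => //; have [] := modular_group_transformation R.
have [+ _] := mod4_invariant w2 irr Gg (Some alpha).
case=> [|a [b [c [d [bc c0 []]]]]].
  exists 0, (- (4 * m)), 1, 0; split=> //; [ring| |by right].
  by rewrite add0r divr1.
rewrite gE => -[/eqP]; rewrite eq_sym -subr_eq0 opprK => /eqP ac.
have [c1 a0] : c + 1 = 0 /\ a = 0.
  apply: irr; rewrite intrD.
  transitivity (c%:~R * ((a%:~R + alpha) / c%:~R + alpha)).
    by field; rewrite intr_eq0.
  by rewrite ac mulr0.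
have {}c1 : c = -1 by lia.
by rewrite c1 a0 in bc *; lia.
Qed.
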